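(* Let $(n_k)_{k\ge0}$ be a strictly increasing sequence of positive integers and $\mathcal N=\{n_k:k\ge0\}$. Suppose that $n_{k+1}/n_k\to b$, where $b\ge2$ is an integer. Then $$\alpha(\mathcal N)=2\sin\frac{\pi}{b+1}.$$
   Context: For $B,t>0$, $h_{\mathcal N}(B,t):=\max\{|1-e^{int}|:n\in\mathcal N,\ nt\le B\}$ (the maximum of the empty set being $0$), and $\alpha(\mathcal N):=\lim_{B\to\infty}\liminf_{t\downarrow0}h_{\mathcal N}(B,t)$; the limit exists by monotonicity in $B$. *)

(* Defs.v *)
From mathcomp Require Import all_boot all_order all_algebra.
From mathcomp Require Import all_classical all_reals all_analysis.
From mathcomp Require Import finmap complex.

Set Implicit Arguments.
Unset Strict Implicit.
Unset Printing Implicit Defensive.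

Import Order.TTheory GRing.Theory Num.Theory.
Import numFieldNormedType.Exports.

Local Open Scope classical_set_scope.
Local Open Scope ring_scope.

Section alpha.
Context {R : realType}.
Implicit Types (N : set nat) (B t : R).

(* e^{ix}, by Euler's formula *)
Definition expi (x : R) : R[i] := (cos x +i* sin x)%C.

(* The norm of R[i] takes values in R[i]; complex.Re brings |1 - e^{int}| back
   to R. *)
Definition chord (n : nat) t : R := complex.Re `|1 - expi (n%:R * t)|.

(* The maximum is over a finite set when t > 0 (see finite_hdom); for t <= 0,
   which is never used, the finitely supported big operator may be junk. *)
Definition h N B t : R :=
  \big[Num.max/0]_(n \in [set n | N n /\ n%:R * t <= B]) chord n t.

Definition alpha N : \bar R :=
  lim (limf_einf (fun t => (h N B t)%:E) 0^'+ @[B --> +oo%R]).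

Lemma chord_ge0 n t : 0 <= chord n t.
Proof. by rewrite /chord normc_def /= sqrtr_ge0. Qed.

Lemma finite_hdom N B t : 0 < t ->
  finite_set [set n | N n /\ n%:R * t <= B].
Proof.
move=> t0.
apply: (@sub_finite_set _ _ `I_(Num.bound `|B / t|)); last exact: finite_II.
move=> n [_]; rewrite -ler_pdivlMr// => nB /=.
rewrite -(ltr_nat R); apply: (le_lt_trans nB).
by apply: (le_lt_trans (ler_norm _)); exact: archi_boundP.
Qed.

Lemma chord_le_h N B t n : 0 < t -> N n -> n%:R * t <= B ->
  chord n t <= h N B t.
Proof.
move=> t0 Nn nB; rewrite /h; case: finite_supportP => [nf|X _ XE _].
  by exfalso; apply: nf; apply: finite_setIl; exact: finite_hdom.
have [nX|nX] := boolP (n \in X).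
  by apply: (@Order.TotalTheory.le_bigmax_seq _ R _ _ 0 n xpredT).
rewrite XE//; elim/big_ind : _ => // [x y x0 y0|i _]; last exact: chord_ge0.
by rewrite le_max x0.
Qed.

Lemma h_attained N B t : 0 < t ->
  [set n | N n /\ n%:R * t <= B] !=set0 ->
  exists n, [/\ N n, n%:R * t <= B & h N B t = chord n t].
Proof.
move=> t0 [m [Nm mB]].
have [h0|h0] := eqVneq (h N B t) 0.
  exists m; split => //; apply/eqP; rewrite eq_le chord_le_h// andbT h0.
  exact: chord_ge0.
move: h0; rewrite /h; case: finite_supportP => [_|X XD _ _].
  by rewrite big_nil eqxx.
set s := enum_fset X => h0.
have : forall i, i \in s -> N i /\ i%:R * t <= B by move=> i; exact: XD.
elim: s h0 => [|i s ih]; first by rewrite big_nil eqxx.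
rewrite big_cons; case: leP => [_ h0 H|_ _ H].
  by apply: ih => // j js; apply: H; rewrite inE js orbT.
by have [] := H i (mem_head _ _); exists i.
Qed.

Lemma h_eq0 N B t : [set n | N n /\ n%:R * t <= B] = set0 -> h N B t = 0.
Proof.
move=> E; rewrite /h; case: finite_supportP => [_|X XD _ _].
  by rewrite big_nil.
rewrite big_seq big_pred0// => i; apply/negP => iX.
by have := XD _ iX; rewrite E.
Qed.

Lemma h_ge0 N B t : 0 <= h N B t.
Proof.
rewrite /h; elim/big_ind : _ => // [x y x0 y0|n _]; first by rewrite le_max x0.
exact: chord_ge0.
Qed.

Lemma le_h N B1 B2 t : 0 < t -> B1 <= B2 -> h N B1 t <= h N B2 t.
Proof.
move=> t0 B12.
have [E|/set0P/(h_attained t0)[n [Nn nB ->]]] :=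
  eqVneq [set n | N n /\ n%:R * t <= B1] set0.
  by rewrite (h_eq0 E) h_ge0.
by apply: chord_le_h => //; exact: le_trans B12.
Qed.

Lemma is_cvg_alpha N :
  cvg (limf_einf (fun t => (h N B t)%:E) 0^'+ @[B --> +oo%R]).
Proof.
apply/cvg_ex; eexists; apply: nondecreasing_cvge => B1 B2 B12.
rewrite !limf_einfE; apply: ge_ereal_sup => _ [V V0 <-].
apply: (@le_trans _ _ (ereal_inf
  [set (h N B2 t)%:E | t in V `&` [set t | 0 < t]])); last first.
  apply: ereal_sup_ubound; exists (V `&` [set t | 0 < t]) => //.
  by apply: filterI => //; exact: nbhs_right_gt.
apply: le_ereal_inf_tmp => _ [t [Vt t0] <-].
apply: (@le_trans _ _ (h N B1 t)%:E); last by rewrite lee_fin le_h.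
by apply: ereal_inf_lbound; exists t.
Qed.

End alpha.

(* Main.v *)
Require Import Defs.
From mathcomp Require Import all_boot all_order all_algebra.
From mathcomp Require Import all_classical all_reals all_analysis.
From mathcomp Require Import complex ring lra.
Import Order.TTheory GRing.Theory Num.Theory.
Import numFieldNormedType.Exports.
Local Open Scope classical_set_scope.
Local Open Scope ring_scope.

(** Half of the chord spanned by the angle [n t] is [|sin (n t / 2)|]
([chordE]), so everything is about the half-angles [n_k t / 2] modulo [pi].
Put [a = pi / (b + 1)], so that [b a = pi - a]. The claim is that, for each
[B >= 2 pi], the lower limit of [h B t] as [t] decreases to [0] is already
equal to [2 sin a]; the limit in [B] is then that of an eventually constant
function.

For the lower bound ([h_eventually_ge]), let [k + 1] be the first index whose
half-angle is at least [a]. The previous half-angle is below [a] and, for small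
[t], the index [k] is so large that [n_(k+1) / n_k] is about [b]; hence the
half-angle of index [k + 1] does not exceed [b a = pi - a] by more than a small
amount. Between [a] and [pi - a] the sine is at least [sin a]. So a single term
of the sequence, with [n_(k+1) t <= 2 pi], always gives a chord of length almost
[2 sin a]: the half-angles cannot jump over the interval [a, pi - a].

For the upper bound ([h_frequently_le]), choose the times [t_k = 2 a / n_k], at
which the half-angle of index [k] is exactly [a]. The earlier half-angles lie in
[0, a]. The half-angle of index [k + j] tends to [b ^ j a] as [k] grows, and
since [b] is congruent to [-1] modulo [b + 1], [b ^ j a] equals [a] or [- a]
modulo [pi] ([norm_sin_expn_pi]). For a given [B] only boundedly many [j]
satisfy [n_(k+j) t_k <= B], so the convergence is uniform over the terms that
enter the maximum. *)

(** * Bounds on a lower limit along a filter *)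

Section lower_limits.
Context {T : choiceType} {X : filteredType T} {R : realType}.

Lemma limf_einf_ge (f : X -> R) (F : set_system X) (l : R) :
  (forall e, 0 < e -> \forall t \near F, l - e <= f t) ->
  (l%:E <= limf_einf (fun t => (f t)%:E) F)%E.
Proof.
move=> H; apply/lee_subgt0Pr => e /H Fe; rewrite limf_einfE.
apply: le_trans (ereal_sup_ubound _); last first.
  by exists (fun t => l - e <= f t).
by apply: le_ereal_inf_tmp => _ [t /= Ht <-]; rewrite -EFinB lee_fin.
Qed.

Lemma limf_einf_le (f : X -> R) (F : set_system X) (l : R) :
  (forall e (V : set X), 0 < e -> F V -> exists2 t, V t & f t <= l + e) ->
  (limf_einf (fun t => (f t)%:E) F <= l%:E)%E.
Proof.
move=> H; rewrite limf_einfE; apply: ge_ereal_sup => _ [V FV <-].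
apply/lee_addgt0Pr => e e0; have [t Vt ft] := H e V e0 FV.
apply: (@le_trans _ _ (f t)%:E); last by rewrite -EFinD lee_fin.
by apply: ereal_inf_lbound; exists t.
Qed.

End lower_limits.

(** * Chords and the sine function *)

Section sine.
Context {R : realType}.
Implicit Types (a x : R).

Lemma chordE n x : chord n x = 2 * `|sin (n%:R * x / 2)| :> R.
Proof.
rewrite /chord normc_def /=.
set y := n%:R * x / 2; have -> : n%:R * x = y *+ 2 by rewrite /y; lra.
rewrite cos_mulr2n sin_mulr2n.
have -> : (1 - (cos y ^+ 2 *+ 2 - 1)) ^+ 2 + (0 - cos y * sin y *+ 2) ^+ 2
    = (2 * sin y) ^+ 2.
  by have c2 := cos2sin2 y; rewrite sub0r; ring: c2.
by rewrite sqrtr_sqr normrM ger0_norm.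
Qed.

Lemma ler_sin : {in `[- (pi / 2), pi / 2] &, {mono @sin R : x y / x <= y}}.
Proof. by apply: le_mono_in => x y xI yI; rewrite ltr_sin. Qed.

(** The sine increases up to [pi / 2] and is symmetric about it. *)
Lemma sin_ge_between a x : 0 <= a -> a <= x <= pi - a -> sin a <= sin x.
Proof.
move=> a0 /andP[ax xa]; have pi0 := pi_gt0 R.
have [x2|x2] := leP x (pi / 2).
  by rewrite ler_sin// !in_itv /=; apply/andP; split; lra.
have -> : sin x = sin (pi - x) by rewrite sinB sinpi cospi; lra.
by rewrite ler_sin ?in_itv /=; [|apply/andP; split..]; lra.
Qed.

Lemma norm_sin_natpiB m x : `|sin (m%:R * pi - x)| = `|sin x|.
Proof.
elim: m => [|m IH]; first by rewrite mul0r sub0r sinN normrN.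
rewrite -natr1 mulrDl mul1r addrAC sinDpi normrN; exact: IH.
Qed.

(** Multiplication by [b] sends [pi / (b + 1)] to [pi - pi / (b + 1)]; at each
further step it preserves the property of being [+- pi / (b + 1)] modulo [pi],
because [b] is an integer. *)
Lemma norm_sin_expn_pi (b j : nat) :
  `|sin (b%:R ^+ j * (pi / b.+1%:R))| = `|sin (pi / b.+1%:R)| :> R.
Proof.
elim: j => [|j IH]; first by rewrite mul1r.
(* b ^ (j + 1) a = b ^ j (pi - a), which is b ^ j pi - b ^ j a *)
rewrite -IH -[RHS](norm_sin_natpiB (b ^ j)) natrX exprS -natr1.
by congr (`|sin _|); field; rewrite natr1 pnatr_eq0.
Qed.

End sine.

(** * Sequences whose consecutive ratios tend to an integer *)

Section ratio.
Context {R : realType} {n : nat -> nat} {b : nat}.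
Context (n_incr : forall i j : nat, (i < j)%N -> (n i < n j)%N).
Context (n_pos : forall k : nat, (0 < n k)%N).
Context (b_ge2 : (2 <= b)%N).
Context (ratio_cvg :
  (n k.+1)%:R / (n k)%:R @[k --> \oo] --> (b%:R : R)).

Let a : R := pi / b.+1%:R.

Let a_gt0 : 0 < a. Proof. by rewrite divr_gt0// pi_gt0. Qed.

Let ba : b%:R * a = pi - a.
Proof. by rewrite /a -natr1; field; rewrite natr1 pnatr_eq0. Qed.

Let a_le_pihalf : a <= pi / 2.
Proof.
have : 2%:R * a <= b%:R * a by rewrite ler_pM2r// ler_nat.
by rewrite ba; have := a_gt0; lra.
Qed.

Let sina_ge0 : 0 <= sin a.
Proof.
by apply: sin_ge0_pi; have := a_gt0; have := a_le_pihalf; have := pi_gt0 R; lra.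
Qed.

Let nR_gt0 k : 0 < (n k)%:R :> R. Proof. by rewrite ltr0n. Qed.

Let n_le i j : (i <= j)%N -> (n i <= n j)%N.
Proof. by rewrite leq_eqVlt => /predU1P[->//|/n_incr/ltnW]. Qed.

Let n_ge k : (k <= n k)%N.
Proof. by elim: k => // k /leq_ltn_trans; apply; exact: n_incr. Qed.

(** The [j]-step ratio is a product of [j] consecutive ratios; the limit is for
fixed [j], with no uniformity in [j]. *)
Lemma iter_ratio_cvg j :
  (n (k + j)%N)%:R / (n k)%:R @[k --> \oo] --> (b%:R ^+ j : R).
Proof.
elim: j => [|j IH].
  apply: cvg_near_cst; near=> k.
  by rewrite addn0 divff// gt_eqF.
rewrite exprS.
have step : (n (k + j).+1)%:R / (n (k + j)%N)%:R @[k --> \oo] --> (b%:R : R).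
  by have := ratio_cvg; rewrite -(cvg_shiftn j).
apply: cvg_trans (cvgM step IH); apply: near_eq_cvg; near=> k => /=.
by rewrite addnS; field; rewrite !gt_eqF.
Unshelve. all: by end_near. Qed.

(** Good times are [2 a / n_k]: the chord of index [k] is then exactly [2 sin a],
the earlier ones are shorter, and the finitely many later ones that count are
close to [2 sin a]. *)
Lemma h_frequently_le (B e : R) (V : set R) : 0 < e -> nbhs 0^'+ V ->
  exists2 t, V t & h (range n) B t <= 2 * sin a + e.
Proof.
move=> e0 V0.
have a2_gt0 : 0 < 2 * a by rewrite mulr_gt0.
pose t k : R := 2 * a / (n k)%:R.
have t_gt0 k : 0 < t k by rewrite divr_gt0// mulr_gt0.
have t_cvg : t k @[k --> \oo] --> 0^'+.
  suff t_cvg0 : t k @[k --> \oo] --> (0 : R).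
    move=> W W0.
    have tW : \forall k \near \oo, 0 < t k -> W (t k) := t_cvg0 _ W0.
    by apply: filterS tW => k; apply; exact: t_gt0.
  apply/cvgrPdist_lt => r r0; near=> k.
  rewrite sub0r normrN gtr0_norm// ltr_pdivrMr// -ltr_pdivrMl//.
  apply: (@lt_le_trans _ _ k%:R); last by rewrite ler_nat.
  by near: k; exact: nbhs_infty_gtr.
have chord_cvg j : chord (n (k + j)%N) (t k) @[k --> \oo] --> 2 * sin a.
  have -> : 2 * sin a = 2 * `|sin (b%:R ^+ j * a)|.
    by rewrite norm_sin_expn_pi ger0_norm.
  have -> : (fun k => chord (n (k + j)%N) (t k)) =
      (fun k => 2 * `|sin ((n (k + j)%N)%:R / (n k)%:R * a)|).
    apply/funext => k; rewrite chordE /t; do 3 congr (_ _).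
    by field; rewrite gt_eqF.
  apply: cvgM; first exact: cvg_cst.
  apply: cvg_norm; apply: continuous_cvg; first exact: continuous_sin.
  by apply: cvgMl; exact: iter_ratio_cvg.
(* b ^ j > j, so from this J on the angle b ^ J (2 a) exceeds B *)
pose J := Num.bound `|B / (2 * a)|.
have past_B : \forall k \near \oo, B < (n (k + J)%N)%:R * t k.
  have : B / (2 * a) < b%:R ^+ J.
    apply: le_lt_trans (ler_norm _) _; apply: lt_le_trans (archi_boundP _) _ => //.
    by rewrite -natrX ler_nat ltnW// ltn_expl.
  move/(cvgr_gt _ (iter_ratio_cvg J)); apply: filterS => k.
  rewrite ltr_pdivrMr// => /lt_le_trans; apply.
  by rewrite /t le_eqVlt; apply/orP; left; apply/eqP; field; rewrite gt_eqF.
have good : \forall k \near \oo, forall j : 'I_J,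
    chord (n (k + j)%N) (t k) <= 2 * sin a + e.
  apply: filter_forall => j; have := chord_cvg j => /cvgr_le; apply.
  by rewrite ltrDl.
have [k [Vk Bk gk]] : exists k, [/\ V (t k), B < (n (k + J)%N)%:R * t k &
    forall j : 'I_J, chord (n (k + j)%N) (t k) <= 2 * sin a + e].
  near \oo => k; exists k; split; near: k => //.
  exact: t_cvg.
exists (t k) => //.
have [E|/set0P/(h_attained (t_gt0 k))[_ [[i _ <-] iB ->]]] :=
  eqVneq [set m | range n m /\ m%:R * t k <= B] set0.
  by rewrite (h_eq0 E) addr_ge0 ?mulr_ge0// ltW.
(* an index below k has half-angle at most a <= pi / 2, where sin increases *)
have [ik|ki] := ltnP i k.
  rewrite chordE /t.
  have y0 : 0 <= (n i)%:R * (2 * a / (n k)%:R) / 2.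
    by rewrite divr_ge0// mulr_ge0// divr_ge0// mulr_ge0// ltW.
  have ya : (n i)%:R * (2 * a / (n k)%:R) / 2 <= a.
    have -> : (n i)%:R * (2 * a / (n k)%:R) / 2 = (n i)%:R / (n k)%:R * a.
      by field; rewrite gt_eqF.
    by rewrite ler_piMl ?(ltW a_gt0)// ler_pdivrMr// mul1r ler_nat n_le// ltnW.
  set y := _ / 2 in y0 ya *.
  have ? := a_le_pihalf; have ? := pi_gt0 R.
  rewrite ger0_norm; last by apply: sin_ge0_pi; lra.
  have : sin y <= sin a by rewrite ler_sin ?in_itv /=; lra.
  lra.
have iJ : (i - k < J)%N.
  rewrite ltnNge; apply/negP => Ji; have := le_lt_trans iB Bk.
  by rewrite ltr_pM2r// ltr_nat ltnNge n_le// -leq_subRL.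
by have := gk (Ordinal iJ); rewrite /= subnKC.
Unshelve. all: by end_near. Qed.

(** The first half-angle to reach [a] cannot overshoot [pi - a] by much, since
the preceding one was below [a] and is multiplied by almost exactly [b]. The
angle itself is then at most [2 pi], whence the condition on [B]. *)
Lemma h_eventually_ge (B e : R) : pi *+ 2 <= B -> 0 < e ->
  \forall t \near 0^'+, 2 * sin a - e <= h (range n) B t.
Proof.
move=> piB e0.
(* d is the tolerance on the ratio; it moves the half-angle by at most d * a *)
have [d [d0 d1 sind]] : exists d : R,
    [/\ 0 < d, d < 1 & sin a - e / 2 <= sin (a - d * a)].
  have sin_cvg : sin (a - d * a) @[d --> 0^'+] --> sin a.
    apply: cvg_at_right_filter.
    apply: continuous_cvg; first exact: continuous_sin.
    have a0 : a - 0 * a = a by rewrite mul0r subr0.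
    rewrite -[X in _ --> X]a0.
    by apply: cvgB; [exact: cvg_cst|apply: cvgMl; exact: cvg_id].
  near (0 : R)^'+ => d; exists d; split.
  - by near: d; exact: nbhs_right_gt.
  - by near: d; exact: nbhs_right_lt.
  - near: d; move/cvgr_ge : sin_cvg; apply; lra.
have [K _ ratioK] : \forall k \near \oo, (n k.+1)%:R / (n k)%:R <= b%:R + d.
  by move/cvgr_le : ratio_cvg; apply; rewrite ltrDl.
have tK0 : 0 < a * 2 / (n K)%:R by rewrite divr_gt0// mulr_gt0.
near=> t.
have t0 : 0 < t by near: t; exact: nbhs_right_gt.
have tK : (n K)%:R * t / 2 < a.
  by rewrite ltr_pdivrMr// mulrC -ltr_pdivlMr.
have ex : exists k, a <= (n k)%:R * t / 2.
  exists (Num.bound `|2 * a / t|).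
  rewrite ler_pdivlMr// mulrC -ler_pdivrMr//.
  apply: le_trans (ler_norm _) _; apply: le_trans (ltW (archi_boundP _)) _ => //.
  by rewrite ler_nat.
case: (ex_minnP ex) => k ak kmin.
have Kk : (K < k)%N.
  rewrite ltnNge; apply/negP => kK; have := lt_le_trans tK ak.
  by rewrite ltr_pM2r// ltr_pM2r// ltr_nat ltnNge n_le.
case: k => [//|k] in ak kmin Kk *.
have ka : (n k)%:R * t / 2 < a.
  by rewrite ltNge; apply/negP => /kmin; rewrite ltnn.
have := ratioK k Kk; rewrite /= ler_pdivrMr// => nk.
have kpi : (n k.+1)%:R * t / 2 <= pi - (a - d * a).
  have -> : pi - (a - d * a) = (b%:R + d) * a by rewrite mulrDl ba; lra.
  apply: (@le_trans _ _ ((b%:R + d) * (n k)%:R * t / 2)).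
    by rewrite ler_pM2r// ler_pM2r.
  rewrite -!mulrA ler_pM2l; last by rewrite ltr_wpDl.
  by rewrite mulrA ltW.
have da : 0 <= a - d * a by rewrite subr_ge0 ler_piMl ?(ltW a_gt0)// ltW.
apply: le_trans (chord_le_h t0 (imageT n k.+1) _); last by rewrite mulr2n in piB; lra.
rewrite chordE.
have sin_y : sin (a - d * a) <= sin ((n k.+1)%:R * t / 2).
  apply: sin_ge_between => //; rewrite kpi andbT; have := mulr_gt0 d0 a_gt0; lra.
have := ler_norm (sin ((n k.+1)%:R * t / 2)); lra.
Unshelve. all: by end_near. Qed.

End ratio.

Theorem proposition6p5 (R : realType) (n : nat -> nat) (b : nat)
    (n_incr : forall i j : nat, (i < j)%N -> (n i < n j)%N)
    (n_pos : forall k : nat, (0 < n k)%N)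
    (b_ge2 : (2 <= b)%N)
    (ratio_cvg :
      (n k.+1)%:R / (n k)%:R @[k --> \oo] --> (b%:R : R)) :
  alpha (range n) = (2 * sin (pi / b.+1%:R))%:E :> \bar R.
Proof.
apply: cvg_lim => //; apply: cvg_near_cst; near=> B.
apply/eqP; rewrite eq_le; apply/andP; split.
  by apply: limf_einf_le => e V; exact: h_frequently_le.
by apply: limf_einf_ge => e; exact: h_eventually_ge.
Unshelve. all: by end_near. Qed.
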